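(* In the log-linear model $$\eta_{jk}=\log\mu_{jk}=\alpha+\rho_j+\gamma_k+z_{jk}^T\vec\theta,\qquad 0\le j\le J,\ 0\le k\le K,$$ let $D=\mathrm{diag}\{\vec\mu\}$, let $$\mathrm{Cov}_{MR}(\vec R)=D\,P^D_{\mathscr R^{\bot_D}}=D(\mathbb I-P^D_{\mathscr R})$$ be the covariance matrix of $\vec R$ for the sampling scheme (MR), let $E=(\vec e_{+1},\dots,\vec e_{+K})$ (an $I\times K$ matrix), and let $Z=(z_{jk})$ be the $(J+1)(K+1)\times L$ matrix with rows $z_{jk}^T$, $0\le j\le J$, $0\le k\le K$. Then for each of the sampling schemes (P), (M), (MR) and (MC) the asymptotic covariance matrix of the estimator $\vec{\hat\theta}$ is $$\Sigma_{\hat\theta}=\Bigl[Z^T\mathrm{Cov}_{MR}(\vec R)Z-Z^T\mathrm{Cov}_{MR}(\vec R)E\bigl(E^T\mathrm{Cov}_{MR}(\vec R)E\bigr)^{-1}E^T\mathrm{Cov}_{MR}(\vec R)Z\Bigr]^{-1}.$$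
   Context: Tables. $J,K\ge 1$ are integers and $I=(J+1)(K+1)$. Tables $a=(a_{jk})$ with $0\le j\le J$, $0\le k\le K$ are identified with vectors $\vec a\in\mathbb R^I$ by stacking columns; rows of $Z$ are ordered accordingly. $\vec e_{jk}\in\mathbb R^I$ is the unit vector of the table with a one at position $(j,k)$ and zeros elsewhere; a subscript $+$ denotes summation over the replaced index, e.g. $\vec e_{j+}=\sum_k\vec e_{jk}$, $\vec e_{+k}=\sum_j\vec e_{jk}$, $\vec e_{++}=\sum_{j,k}\vec e_{jk}$. Spaces. $\mathscr D=\mathrm{span}\{\vec e_{++}\}$, $\mathscr R=\mathrm{span}\{\vec e_{0+},\dots,\vec e_{J+}\}$, $\mathscr C=\mathrm{span}\{\vec e_{+0},\dots,\vec e_{+K}\}$. Projections. For a symmetric positive definite $I\times I$ matrix $D$ and a linear subspace $\mathscr M\subset\mathbb R^I$, $P^D_{\mathscr M}$ is the ($I\times I$ matrix of the) orthogonal projection onto $\mathscr M$ with respect to the inner product $\langle a,b\rangle_D=a^TDb$, and $\mathscr M^{\bot_D}$ is the orthogonal complement with respect to this inner product. $\mathbb I$ is the identity matrix. Model. $R=(R_{jk})$ is a random table of counts with expected table $\mu=(\mu_{jk})=\mathbb E(R)$, all $\mu_{jk}>0$, $\eta_{jk}=\log\mu_{jk}$. The model is $\eta_{jk}=\alpha+\rho_j+\gamma_k+z_{jk}^T\vec\theta$ with $\rho_0=\gamma_0=0$, known vectors $z_{jk}\in\mathbb R^L$ with $z_{j0}=z_{0k}=0$ for all $j,k$, and unknown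 $\vec\theta\in\mathbb R^L$; the parameters $\alpha$, $\rho_j$ $(j>0)$, $\gamma_k$ $(k>0)$, $\vec\theta$ are otherwise unrestricted. $\mathscr H\subset\mathbb R^I$ is the linear space of all vectors $\vec\eta$ of this form. The $JK\times L$ matrix $Z^\circ$ with rows $z_{jk}^T$, $j,k>0$, is assumed to have rank $L$. Sampling schemes. (M): $\vec R$ is multinomial with fixed total $n$; (P): the $R_{jk}$ are independent Poisson; (MR): the rows of $R$ are independent multinomial with fixed row totals; (MC): the columns of $R$ are independent multinomial with fixed column totals. The associated space is $\mathscr N=\mathscr D$ for (M), $\mathscr N=\{0\}$ for (P), $\mathscr N=\mathscr R$ for (MR), $\mathscr N=\mathscr C$ for (MC). Estimators and asymptotic covariance matrices. $\hat\mu$ is the maximum likelihood estimator of $\mu$ under $\vec\eta\in\mathscr H$, $\hat\eta=\log\hat\mu$, and $\vec{\hat\theta}$ is the parameter value in the model representation of $\hat\eta$ (the parameter $\vec\theta$ is a linear function of $\vec\eta\in\mathscr H$). By a theorem of Haberman (fixed cells, suitably increasing expectations), $\vec{\hat\eta}$ is asymptotically normal with asymptotic covariance matrix $\Sigma_{\hat\eta}=[P^D_{\mathscr H}-P^D_{\mathscr N}]D^{-1}$; this is taken as given. The asymptotic covariance matrix of an estimator that is a linear function $A\vec{\hat\eta}$ of $\vec{\hat\eta}$ is $A\Sigma_{\hat\eta}A^T$. *)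

(* Defs.v *)
From HB Require Import structures.
From mathcomp Require Import all_boot all_order all_algebra.
From mathcomp Require Import ring reals exp.

Set Implicit Arguments.
Unset Strict Implicit.
Unset Printing Implicit Defensive.

Import Order.TTheory GRing.Theory Num.Theory.
Local Open Scope ring_scope.

Section Projections.
Variables (R : realType) (n : nat).
Implicit Types (D : 'M[R]_n) (M : {vspace 'cV[R]_n}).

Definition dotD D (a b : 'cV[R]_n) : R := (a^T *m D *m b) 0 0.

Definition posdef D : Prop :=
  D^T = D /\ forall x : 'cV[R]_n, x != 0 -> 0 < dotD D x x.

Definition vbasis_mx M : 'M[R]_(n, \dim M) :=
  \matrix_(i, k) ((vbasis M)`_k : 'cV[R]_n) i 0.

(* See [orthovP]: the vectors D-orthogonal to all of M. *)
Definition orthov D M : {vspace 'cV[R]_n} :=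
  lker (linfun (mulmx ((vbasis_mx M)^T *m D) : 'cV[R]_n -> 'cV[R]_(\dim M))).

(* The matrix of the projection onto M along its D-orthogonal complement. The
   library's [daddv_pi] is a projection only when the two subspaces are
   supplementary; [oprojP] checks this for positive definite D. *)
Definition oproj D M : 'M[R]_n :=
  \matrix_(i, j) (daddv_pi M (orthov D M) (delta_mx j 0 : 'cV[R]_n) : 'cV[R]_n) i 0.

Lemma dotDDl D a b c : dotD D (a + b) c = dotD D a c + dotD D b c.
Proof. by rewrite /dotD linearD /= !mulmxDl mxE. Qed.

Lemma dotDZl D k a c : dotD D (k *: a) c = k * dotD D a c.
Proof. by rewrite /dotD linearZ /= -!scalemxAl mxE. Qed.

Lemma dotDC D a b : D^T = D -> dotD D a b = dotD D b a.
Proof.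
move=> sD; rewrite /dotD -[in LHS](trmxK (a^T *m D *m b)) [LHS]mxE.
by rewrite !trmx_mul trmxK sD mulmxA.
Qed.

Lemma orthovP D M v :
  reflect (forall m, m \in M -> dotD D m v = 0) (v \in orthov D M).
Proof.
rewrite memv_ker lfunE /=.
have ent k : ((vbasis_mx M)^T *m D *m v) k 0 = dotD D (vbasis M)`_k v.
  rewrite /dotD -!mulmxA !mxE; apply: eq_bigr => i _.
  by rewrite !mxE.
apply: (iffP eqP) => [v0 m mM | h].
  rewrite (coord_vbasis mM).
  elim/big_ind: _ => [|x y hx hy|k _].
  - by rewrite /dotD trmx0 !mul0mx mxE.
  - by rewrite dotDDl hx hy addr0.
  - by rewrite dotDZl -ent v0 mxE mulr0.
apply/matrixP=> k j; rewrite ord1 ent mxE; apply: h.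
by apply: vbasis_mem; apply: mem_nth; rewrite size_tuple.
Qed.

Lemma oprojE D M x : oproj D M *m x = daddv_pi M (orthov D M) x.
Proof.
rewrite {2}(matrix_sum_delta x).
under eq_bigr do rewrite big_ord1.
rewrite linear_sum; apply/matrixP=> i j; rewrite ord1 summxE mxE.
by apply: eq_bigr => k _; rewrite linearZ !mxE mulrC.
Qed.

Lemma capv_orthov D M : posdef D -> (M :&: orthov D M = 0)%VS.
Proof.
move=> [_ pD]; apply/eqP; rewrite -subv0; apply/subvP=> x.
rewrite memv_cap memv0 => /andP[xM /orthovP/(_ _ xM) x0].
by apply: contraTT isT => /pD; rewrite x0 ltxx.
Qed.

Lemma addv_orthov D M : posdef D -> (M + orthov D M = fullv)%VS.
Proof.
move=> pD; apply/eqP; rewrite eqEdim subvf /=.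
rewrite dimv_disjoint_sum ?capv_orthov // dimvf.
rewrite /orthov; set f := linfun _.
have := limg_ker_dim f fullv; rewrite capfv dimvf => <-.
rewrite addnC leq_add2r (leq_trans (dimvS (subvf _))) // dimvf /dim /=.
by rewrite muln1.
Qed.

Lemma oprojP D M x : posdef D ->
  oproj D M *m x \in M /\ x - oproj D M *m x \in orthov D M.
Proof.
move=> pD; rewrite oprojE memv_pi; split=> //.
have := @daddv_pi_add _ _ M (orthov D M) x (capv_orthov M pD).
rewrite addv_orthov // => /(_ (memvf _)) {1}<-.
by rewrite addrC addKr memv_pi.
Qed.

Lemma oproj_unique D M x y : posdef D ->
  y \in M -> x - y \in orthov D M -> oproj D M *m x = y.
Proof.
move=> pD yM xyM; have [pM pxM] := oprojP M x pD.
apply/eqP; rewrite -subr_eq0 -memv0 -(capv_orthov M pD) memv_cap rpredB //=.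
by have := rpredB xyM pxM; rewrite opprB addrCA addrAC subrr add0r addrC.
Qed.

Lemma oproj_orthov D M : posdef D -> oproj D (orthov D M) = 1%:M - oproj D M.
Proof.
move=> pD; apply/matrixP=> i j.
have -> (P : 'M[R]_n) : P i j = (P *m (delta_mx j 0 : 'cV[R]_n)) i 0.
  by rewrite -colE mxE.
have -> (P : 'M[R]_n) : P i j = (P *m (delta_mx j 0 : 'cV[R]_n)) i 0.
  by rewrite -colE mxE.
congr (fun v : 'cV[R]_n => v i 0); set x := delta_mx j 0.
have [pM pxM] := oprojP M x pD.
apply: oproj_unique => //; rewrite mulmxBl mul1mx // subKr.
apply/orthovP=> m /orthovP/(_ _ pM) <-.
exact: dotDC pD.1.
Qed.

End Projections.

Section Tables.
Variables (R : realType) (J K : nat).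

(* [mxvec] reads a matrix row by row, so transposing first stacks columns. *)
Definition vectab (a : 'M[R]_(J.+1, K.+1)) : 'cV[R]_(K.+1 * J.+1) :=
  (mxvec a^T)^T.

Definition cell (j : 'I_J.+1) (k : 'I_K.+1) : 'I_(K.+1 * J.+1) :=
  mxvec_index k j.

Definition evec j k : 'cV[R]_(K.+1 * J.+1) := vectab (delta_mx j k).
Definition erow j : 'cV[R]_(K.+1 * J.+1) := \sum_k evec j k.
Definition ecol k : 'cV[R]_(K.+1 * J.+1) := \sum_j evec j k.
Definition eall : 'cV[R]_(K.+1 * J.+1) := \sum_j \sum_k evec j k.

Definition Dspace : {vspace 'cV[R]_(K.+1 * J.+1)} := <[eall]>%VS.
Definition Rspace : {vspace 'cV[R]_(K.+1 * J.+1)} :=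
  <<[seq erow j | j : 'I_J.+1]>>%VS.
Definition Cspace : {vspace 'cV[R]_(K.+1 * J.+1)} :=
  <<[seq ecol k | k : 'I_K.+1]>>%VS.

(* In the last two the rows, respectively the columns, are independent
   multinomials with fixed totals. *)
Inductive scheme := Poisson | Multinomial | RowMultinomial | ColMultinomial.

Definition Nspace (s : scheme) : {vspace 'cV[R]_(K.+1 * J.+1)} :=
  match s with
  | Poisson => 0%VS
  | Multinomial => Dspace
  | RowMultinomial => Rspace
  | ColMultinomial => Cspace
  end.

Definition Dmx (mu : 'M[R]_(J.+1, K.+1)) : 'M[R]_(K.+1 * J.+1) :=
  diag_mx (vectab mu)^T.

(* The projection formula makes sense for every positive table of means; its
   entries are the multinomial covariances within each row, and zero between
   different rows, see [cov_MR_cell]. *)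
Definition cov_MR (mu : 'M[R]_(J.+1, K.+1)) : 'M[R]_(K.+1 * J.+1) :=
  Dmx mu *m oproj (Dmx mu) (orthov (Dmx mu) Rspace).

Definition Emx : 'M[R]_(K.+1 * J.+1, K) :=
  \matrix_(c, k) ecol (lift ord0 k) c 0.

Lemma vectabE a j k : vectab a (cell j k) 0 = a j k.
Proof. by rewrite mxE mxvecE mxE. Qed.

Lemma cellP c : exists j k, c = cell j k.
Proof. by case/mxvec_indexP: c => k j; exists j, k. Qed.

Lemma cell_inj j k j' k' : cell j k = cell j' k' -> j = j' /\ k = k'.
Proof.
move=> /(congr1 (fun c => vectab (delta_mx j k) c 0)).
rewrite !vectabE !mxE !eqxx /=.
by case: eqP => [->|_]; case: eqP => [->|_] //= /eqP; rewrite oner_eq0.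
Qed.

Lemma Dmx_posdef (mu : 'M[R]_(J.+1, K.+1)) : (forall j k, 0 < mu j k) -> posdef (Dmx mu).
Proof.
move=> mu0; split; first by rewrite tr_diag_mx.
have d0 c : 0 < (vectab mu)^T 0 c.
  by have [j [k ->]] := cellP c; rewrite mxE vectabE.
have dE x : dotD (Dmx mu) x x = \sum_c (vectab mu)^T 0 c * x c 0 ^+ 2.
  rewrite /dotD -mulmxA mul_diag_mx mxE; apply: eq_bigr => c _.
  by rewrite !mxE mulrCA expr2.
move=> x; apply: contraNT; rewrite dE -leNgt => le0.
have ge0 c : true -> 0 <= (vectab mu)^T 0 c * x c 0 ^+ 2.
  by rewrite mulr_ge0 ?sqr_ge0 // ltW.
have := psumr_eq0P ge0 (le_anti _).
rewrite le0 sumr_ge0 // => /(_ isT) h.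
apply/eqP/matrixP=> c j; rewrite ord1 mxE; apply/eqP.
by have /eqP := h c isT; rewrite mulf_eq0 gt_eqF //= sqrf_eq0.
Qed.

Lemma cov_MRE (mu : 'M[R]_(J.+1, K.+1)) : (forall j k, 0 < mu j k) ->
  cov_MR mu = Dmx mu *m (1%:M - oproj (Dmx mu) Rspace).
Proof. by move=> mu0; rewrite /cov_MR oproj_orthov //; exact: Dmx_posdef. Qed.

Lemma erowE j j' k' : erow j (cell j' k') 0 = (j' == j)%:R.
Proof.
rewrite summxE (bigD1 k') //= big1 ?addr0 ?vectabE ?mxE ?eqxx ?andbT // => k kk'.
by rewrite vectabE mxE eq_sym [k' == k]eq_sym (negPf kk') andbF.
Qed.

Lemma memv_erow j : erow j \in Rspace.
Proof. by apply: memv_span; apply/imageP; exists j. Qed.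

Lemma cov_MR_cell (mu : 'M[R]_(J.+1, K.+1)) j k j' k' : (forall j k, 0 < mu j k) ->
  cov_MR mu (cell j k) (cell j' k') =
  if j == j' then mu j k *+ (k == k') - mu j k * mu j k' / \sum_l mu j l else 0.
Proof.
move=> mu0; have pD := Dmx_posdef mu0; rewrite cov_MRE //.
have s0 i : \sum_l mu i l != 0.
  by rewrite gt_eqF // (bigD1 ord0) //= ltr_wpDr // sumr_ge0 // => l _; exact: ltW.
rewrite mul_diag_mx mxE [_ 0 _]mxE vectabE 3!mxE.
set x := delta_mx (cell j' k') 0 : 'cV[R]_(K.+1 * J.+1).
have -> (P : 'M[R]_(K.+1 * J.+1)) c : P c (cell j' k') = (P *m x) c 0.
  by rewrite -colE mxE.
have dotx m y : dotD (Dmx mu) m y = \sum_c m c 0 * (vectab mu c 0 * y c 0).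
  rewrite /dotD -mulmxA mul_diag_mx mxE; apply: eq_bigr => c _.
  by rewrite !mxE.
have -> : oproj (Dmx mu) Rspace *m x = (mu j' k' / \sum_l mu j' l) *: erow j'.
  apply: oproj_unique => //; first by rewrite rpredZ ?memv_erow.
  apply/orthovP => m /coord_span ->.
  elim/big_ind: _ => [|a b ha hb|i _].
  - by rewrite /dotD trmx0 !mul0mx mxE.
  - by rewrite dotDDl ha hb addr0.
  rewrite dotDZl; set e := nth _ _ _.
  have /imageP[i0 _ ->] : e \in [seq erow j | j : 'I_J.+1].
    by apply: mem_nth; rewrite size_tuple.
  rewrite dotx [X in _ * X](_ : _ = 0) ?mulr0 //.
  have -> : \sum_c erow i0 c 0 * (vectab mu c 0 *
      (x - (mu j' k' / (\sum_l mu j' l)) *: erow j') c 0) =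
     \sum_c erow i0 c 0 * (vectab mu c 0 * x c 0) - 
     (mu j' k' / (\sum_l mu j' l)) * \sum_c erow i0 c 0 * (vectab mu c 0 * erow j' c 0).
    rewrite mulr_sumr -sumrB; apply: eq_bigr => c _.
    set y := erow j'; set w := vectab mu c 0; set t := erow i0 c 0.
    by rewrite [X in _ * (_ * X) = _]mxE [X in _ * (_ * (_ + X)) = _]mxE [X in - X]mxE; ring.
  rewrite (bigD1 (cell j' k')) //= big1 ?addr0; last first.
    by move=> c cn; rewrite [x _ _]mxE (negPf cn) !mulr0.
  rewrite erowE vectabE [x _ _]mxE !eqxx mulr1.
  have -> : \sum_c erow i0 c 0 * (vectab mu c 0 * erow j' c 0) =
            \sum_p \sum_l erow i0 (cell p l) 0 * (mu p l * erow j' (cell p l) 0).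
    rewrite exchange_big pair_big /=.
    rewrite (reindex _ (curry_mxvec_bij K.+1 J.+1)) /=.
    by apply: eq_bigr => -[l p] _ /=; rewrite vectabE.
  rewrite (bigD1 j') //= [X in _ * (_ + X)]big1 ?addr0; last first.
    by move=> p pj; rewrite big1 // => l _; rewrite (erowE j') (negPf pj) !mulr0.
  rewrite [X in _ - _ * X](eq_bigr (fun l => (j' == i0)%:R * mu j' l)); last first.
    by move=> l _; rewrite !erowE eqxx mulr1.
  by rewrite -mulr_sumr mulrCA divfK // subrr.
rewrite [X in _ - X]mxE erowE.
have -> : (cell j k == cell j' k') = (j == j') && (k == k').
  apply/eqP/andP => [/cell_inj [-> ->] //|[/eqP-> /eqP-> //]].
case: (eqVneq j j') => [<-|_] /=; last by rewrite mulr0 subrr mulr0.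
by rewrite mulr1 mulrBr mulr_natr mulrA.
Qed.

End Tables.

Section Model.
Variables (R : realType) (J K L : nat) (z : 'I_J.+1 -> 'I_K.+1 -> 'cV[R]_L).

Definition linpred (alpha : R) (rho : 'I_J.+1 -> R) (gamma : 'I_K.+1 -> R)
    (theta : 'cV[R]_L) : 'M[R]_(J.+1, K.+1) :=
  \matrix_(j, k) (alpha + rho j + gamma k + ((z j k)^T *m theta) 0 0).

Definition ext0 n (v : 'cV[R]_n) (i : 'I_n.+1) : R :=
  if unlift ord0 i is Some i' then v i' 0 else 0.

(* The image of the space of free parameters alpha, (rho_j)_(j > 0),
   (gamma_k)_(k > 0), theta; see [HspaceP]. *)
Definition param_map (p : R^o * 'cV[R]_J * 'cV[R]_K * 'cV[R]_L) :
    'cV[R]_(K.+1 * J.+1) :=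
  let: (alpha, rho, gamma, theta) := p in
  vectab (linpred alpha (ext0 rho) (ext0 gamma) theta).

Definition Hspace : {vspace 'cV[R]_(K.+1 * J.+1)} := limg (linfun param_map).

Definition Zmx : 'M[R]_(K.+1 * J.+1, L) :=
  \matrix_(c, l) vectab (\matrix_(j, k) z j k l 0) c 0.

Definition Zcore : 'M[R]_(K * J, L) :=
  \matrix_(c, l)
    ((mxvec (\matrix_(k < K, j < J) z (lift ord0 j) (lift ord0 k) l 0))^T) c 0.

Lemma ZmxE j k l : Zmx (cell j k) l = z j k l 0.
Proof. by rewrite mxE vectabE mxE. Qed.

Lemma ZcoreE j k l :
  Zcore (mxvec_index k j) l = z (lift ord0 j) (lift ord0 k) l 0.
Proof. by rewrite !mxE mxvecE mxE. Qed.

Lemma ext0_0 n (v : 'cV[R]_n) : ext0 v ord0 = 0.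
Proof. by rewrite /ext0 unlift_none. Qed.

Lemma ext0P n (f : 'I_n.+1 -> R) :
  f ord0 = 0 -> ext0 (\col_i f (lift ord0 i)) =1 f.
Proof.
by move=> f0 i; rewrite /ext0; case: unliftP => [i' ->|->]; rewrite ?mxE.
Qed.

Fact param_map_is_linear : linear param_map.
Proof.
move=> a [[[x1 r1] g1] t1] [[[x2 r2] g2] t2].
apply/matrixP=> c i; rewrite ord1; have [j [k ->]] := cellP c.
rewrite [RHS]mxE [X in _ = X + _]mxE !vectabE !mxE.
have e n (u v : 'cV[R]_n) l : ext0 (a *: u + v) l = a * ext0 u l + ext0 v l.
  by rewrite /ext0; case: unlift => [l'|]; rewrite ?mxE ?mulr0 ?addr0.
rewrite !e.
have -> : \sum_l (z j k)^T 0 l * (a *: t1 + t2) l 0 =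
    a * (\sum_l (z j k)^T 0 l * t1 l 0) + \sum_l (z j k)^T 0 l * t2 l 0.
  rewrite mulr_sumr -big_split; apply: eq_bigr => l _ /=.
  by rewrite !mxE mulrDr mulrCA.
set s1 := \sum_l _; set s2 := \sum_l _.
change (a * x1 + x2 + (a * ext0 r1 j + ext0 r2 j) +
  (a * ext0 g1 k + ext0 g2 k) + (a * s1 + s2) =
  a * (x1 + ext0 r1 j + ext0 g1 k + s1) + (x2 + ext0 r2 j + ext0 g2 k + s2)).
ring.
Qed.

HB.instance Definition _ :=
  GRing.isLinear.Build R _ _ _ param_map param_map_is_linear.

Lemma HspaceP eta : reflect
  (exists alpha rho gamma theta,
    [/\ rho ord0 = 0, gamma ord0 = 0
      & eta = vectab (linpred alpha rho gamma theta)])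
  (eta \in Hspace).
Proof.
apply: (iffP memv_imgP) => [[[[[a r] g] t] _ ->]|[a [r [g [t [r0 g0 ->]]]]]].
  by exists a, (ext0 r), (ext0 g), t; rewrite !ext0_0 lfunE.
exists (a, \col_i r (lift ord0 i), \col_i g (lift ord0 i), t); first exact: memvf.
rewrite lfunE /=; congr vectab; apply/matrixP=> j k.
by rewrite !mxE !ext0P.
Qed.

(* A represents theta as a linear function of eta in Hspace; off Hspace it is
   arbitrary. The rank assumption makes theta identifiable, see
   [theta_map_exists]. *)
Definition theta_map (A : 'M[R]_(L, K.+1 * J.+1)) : Prop :=
  forall alpha rho gamma theta, rho ord0 = 0 -> gamma ord0 = 0 ->
    A *m vectab (linpred alpha rho gamma theta) = theta.

Lemma theta_map_exists : (forall j, z j ord0 = 0) -> (forall k, z ord0 k = 0) ->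
  \rank Zcore = L -> exists A, theta_map A.
Proof.
move=> z0 zz0 rkZ.
have /row_fullP [B BZ] : row_full Zcore by rewrite /row_full rkZ.
pose jj (k : 'I_K) (j : 'I_J) : 'rV[R]_(K.+1 * J.+1) :=
  (evec R (lift ord0 j) (lift ord0 k) - evec R (lift ord0 j) ord0
   - evec R ord0 (lift ord0 k) + evec R ord0 ord0)^T.
pose S : 'M[R]_(K * J, K.+1 * J.+1) :=
  \matrix_(c, d) (mxvec (\matrix_(k, j) jj k j 0 d)) 0 c.
exists (B *m S) => a r g t r0 g0.
rewrite -mulmxA (_ : S *m _ = Zcore *m t) ?mulmxA ?BZ ?mul1mx //.
apply/matrixP=> c i; rewrite ord1; case/mxvec_indexP: c => k j.
set v := vectab _.
have ev j' k' : \sum_d evec R j' k' d 0 * v d 0 = v (cell j' k') 0.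
  rewrite (bigD1 (cell j' k')) //= vectabE mxE !eqxx mul1r big1 ?addr0 // => d.
  have [j2 [k2 ->]] := cellP d => ne; rewrite vectabE mxE.
  case: andP => [[/eqP e1 /eqP e2]|]; last by rewrite mul0r.
  by rewrite e1 e2 eqxx in ne.
have -> : (S *m v) (mxvec_index k j) 0 = v (cell (lift ord0 j) (lift ord0 k)) 0
   - v (cell (lift ord0 j) ord0) 0 - v (cell ord0 (lift ord0 k)) 0
   + v (cell ord0 ord0) 0.
  rewrite -!ev -!sumrB -big_split mxE; apply: eq_bigr => d _ /=.
  rewrite [S _ _]mxE mxvecE [X in X * _ = _]mxE [jj _ _]lock !mxE -lock.
  by rewrite /jj !mxE mulrDl !mulrBl.
have -> : (Zcore *m t) (mxvec_index k j) 0 =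
    ((z (lift ord0 j) (lift ord0 k))^T *m t) 0 0.
  by rewrite !mxE; apply: eq_bigr => l _; rewrite ZcoreE mxE.
have vE j' k' : v (cell j' k') 0 = a + r j' + g k' + ((z j' k')^T *m t) 0 0.
  by rewrite vectabE mxE.
rewrite !vE r0 g0 !z0 !zz0 trmx0 mul0mx (mxE _ (fun _ _ => 0)).
ring.
Qed.

End Model.

Section AsymptoticCovariance.
Variables (R : realType) (J K L : nat) (z : 'I_J.+1 -> 'I_K.+1 -> 'cV[R]_L).
Variable mu : 'M[R]_(J.+1, K.+1).

(* The asymptotic covariance matrix of the maximum likelihood estimator of eta
   given by Haberman's theorem. *)
Definition Sigma_eta (s : scheme) : 'M[R]_(K.+1 * J.+1) :=
  (oproj (Dmx mu) (Hspace z) - oproj (Dmx mu) (Nspace R J K s))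
    *m invmx (Dmx mu).

(* The asymptotic covariance matrix of A times an estimator with asymptotic
   covariance matrix Sigma. *)
Definition acov_lin m n (A : 'M[R]_(m, n)) (Sigma : 'M[R]_n) : 'M[R]_m :=
  A *m Sigma *m A^T.

End AsymptoticCovariance.

(* Main.v *)
(* Let T be the D-residual of Z after regression on the row effects and on the
   columns of E. The columns of T lie in H and are D-orthogonal to the row and
   column effects, so T^T D h = S theta for h in H with parameter theta, where
   S is the matrix to be inverted; moreover T itself has parameter matrix 1.
   Since the projections are D-self-adjoint and the parameter theta vanishes on
   N, this gives S A Sigma_eta A^T = T^T A^T = 1 for every sampling scheme. *)
Require Import Defs.
From HB Require Import structures.
From mathcomp Require Import all_boot all_order all_algebra.
From mathcomp Require Import reals exp.

Import Order.TTheory GRing.Theory Num.Theory.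
Set Implicit Arguments.
Unset Strict Implicit.
Unset Printing Implicit Defensive.

Local Open Scope ring_scope.

Lemma eq_mulmxcV (R : realType) (m n : nat) (A B : 'M[R]_(m, n)) :
  (forall x : 'cV[R]_n, A *m x = B *m x) -> A = B.
Proof.
move=> AB; apply/matrixP=> i j.
by have /matrixP/(_ i 0) := AB (delta_mx j 0); rewrite -!colE !mxE.
Qed.

Lemma inj_unitmx (R : realType) (n : nat) (A : 'M[R]_n) :
  (forall x : 'cV[R]_n, A *m x = 0 -> x = 0) -> A \in unitmx.
Proof.
move=> injA; rewrite -unitmx_tr -row_free_unit; apply: inj_row_free => v vA.
by apply: trmx_inj; rewrite trmx0; apply: injA; rewrite -[A]trmxK -trmx_mul vA trmx0.
Qed.

(** * Self-adjointness and idempotence of the projections for a positive definite [D] *)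

Section Projection.
Variables (R : realType) (n : nat) (D : 'M[R]_n).
Hypothesis pD : posdef D.
Implicit Types (M : {vspace 'cV[R]_n}) (x y : 'cV[R]_n).

Lemma posdef_eq0 x : dotD D x x = 0 -> x = 0.
Proof.
by move=> x0; apply/eqP; apply: contraTT isT => /pD.2; rewrite x0 ltxx.
Qed.

Lemma posdef_unitmx : D \in unitmx.
Proof.
apply: inj_unitmx => x Dx; apply: posdef_eq0.
by rewrite /dotD -mulmxA Dx mulmx0 mxE.
Qed.

Lemma oproj_mem M x : oproj D M *m x \in M.
Proof. by have [] := oprojP M x pD. Qed.

Lemma oproj_id M x : x \in M -> oproj D M *m x = x.
Proof. by move=> xM; apply: oproj_unique => //; rewrite subrr mem0v. Qed.

Lemma dotD_oproj M x y :
  y \in M -> dotD D y (oproj D M *m x) = dotD D y x.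
Proof.
move=> yM; have [_ /Defs.orthovP/(_ _ yM)] := oprojP M x pD.
by rewrite /dotD mulmxBr mxE [X in _ + X]mxE => h; rewrite (subr0_eq h).
Qed.

(** Both sides equal the [D]-product of the two projections. *)
Lemma dotD_oproj_sym M x y :
  dotD D (oproj D M *m y) x = dotD D y (oproj D M *m x).
Proof.
rewrite -(dotD_oproj x (oproj_mem M y)) (dotDC _ _ pD.1).
by rewrite (dotD_oproj _ (oproj_mem M x)) (dotDC _ _ pD.1).
Qed.

Lemma oproj_selfadj M : (oproj D M)^T *m D = D *m oproj D M.
Proof.
apply: eq_mulmxcV => x; apply/matrixP=> i j; rewrite ord1 {j}.
(* Entries are read off by pairing with unit vectors, which turns the matrix identity into
   [dotD_oproj_sym]. *)
have ent (B : 'M[R]_n) :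
    (B *m x) i 0 = ((delta_mx i 0 : 'cV[R]_n)^T *m B *m x) 0 0.
  by rewrite trmx_delta -mulmxA -rowE [RHS]mxE.
rewrite !ent mulmxA -trmx_mul [LHS]dotD_oproj_sym /dotD.
by rewrite !mulmxA.
Qed.

Lemma oproj_residual_sym M :
  (1%:M - oproj D M)^T *m D = D *m (1%:M - oproj D M).
Proof.
by rewrite linearB /= trmx1 mulmxBl mulmxBr mul1mx mulmx1 oproj_selfadj.
Qed.

Lemma oproj_idem M : oproj D M *m oproj D M = oproj D M.
Proof. by apply: eq_mulmxcV => x; rewrite -mulmxA oproj_id ?oproj_mem. Qed.

Lemma oproj_residual_idem M :
  (1%:M - oproj D M) *m (1%:M - oproj D M) = 1%:M - oproj D M.
Proof. by rewrite mulmxBr mulmx1 mulmxBl mul1mx oproj_idem subrr subr0. Qed.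

Lemma mul_oproj0 m (A : 'M[R]_(m, n)) M :
  (forall x, x \in M -> A *m x = 0) -> A *m oproj D M = 0.
Proof.
by move=> AM; apply: eq_mulmxcV => x; rewrite mul0mx -mulmxA AM ?oproj_mem.
Qed.

End Projection.

(** * Row and column effects in coordinates *)

Section Tables.
Variables (R : realType) (J K : nat).

Lemma ecolE (k k' : 'I_K.+1) (j' : 'I_J.+1) : ecol R J k (cell j' k') 0 = (k' == k)%:R.
Proof.
rewrite summxE (bigD1 j') //= big1 ?addr0 ?vectabE ?mxE ?eqxx // => j jj'.
by rewrite vectabE mxE eq_sym (negPf jj').
Qed.

Lemma sum_erowE (r : 'I_J.+1 -> R) j k :
  (\sum_j r j *: erow R K j) (cell j k) 0 = r j.
Proof.
rewrite summxE (bigD1 j) //= big1 ?addr0; last first.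
  by move=> i ij; rewrite mxE erowE eq_sym (negPf ij) mulr0.
by rewrite mxE erowE eqxx mulr1.
Qed.

Lemma EmxE (v : 'cV[R]_K) j k : (Emx R J K *m v) (cell j k) 0 = ext0 v k.
Proof.
rewrite mxE /ext0; case: unliftP => [k' ->|->].
  rewrite (bigD1 k') //= big1 ?addr0 => [|i ik]; rewrite mxE ecolE.
    by rewrite eqxx mul1r.
  by rewrite (inj_eq lift_inj) eq_sym (negPf ik) mul0r.
by rewrite big1 // => i _; rewrite mxE ecolE (negPf (neq_lift _ _)) mul0r.
Qed.

Lemma RspaceP x :
  reflect (exists r : 'I_J.+1 -> R, x = \sum_j r j *: erow R K j)
    (x \in Rspace R J K).
Proof.
apply: (iffP idP) => [|[r ->]]; last first.
  by apply: rpred_sum => j _; rewrite rpredZ ?memv_erow.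
rewrite /Rspace => /coord_span ->.
elim/big_ind: _ => [|_ _ [r ->] [r' ->]|i _].
- by exists (fun=> 0); rewrite big1 // => j _; rewrite scale0r.
- exists (fun j => r j + r' j); rewrite -big_split.
  by apply: eq_bigr => j _; rewrite scalerDl.
set c := coord _ _ _; set e := nth _ _ _.
have /imageP[i0 _ ->] : e \in [seq erow R K j | j : 'I_J.+1].
  by apply: mem_nth; rewrite size_tuple.
exists (fun j => c *+ (j == i0)).
rewrite (bigD1 i0) //= big1 ?addr0 ?eqxx // => j /negPf ->.
by rewrite scale0r.
Qed.

(** Elements of the row space are constant along each row, while [Emx R J K *m v] vanishes in column
    0. *)
Lemma Emx_Rspace (v : 'cV[R]_K) : Emx R J K *m v \in Rspace R J K -> v = 0.
Proof.
move=> /RspaceP[r Er].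
have Evr j k : ext0 v k = r j by rewrite -(EmxE v j k) Er sum_erowE.
apply/matrixP=> k i; rewrite ord1 mxE.
have := Evr ord0 (lift ord0 k); rewrite -(Evr ord0 ord0) ext0_0 /ext0.
by rewrite liftK.
Qed.

End Tables.

(** * Decomposition of the model space, and where the parameter theta vanishes *)

Section Model.
Variables (R : realType) (J K L : nat) (z : 'I_J.+1 -> 'I_K.+1 -> 'cV[R]_L).

(** The intercept is absorbed into the row effects, so the model space is the sum of the row space
    and the column spans of E and Z. *)
Lemma linpredE a r (g : 'I_K.+1 -> R) t : g ord0 = 0 ->
  vectab (linpred z a r g t) = \sum_j (a + r j) *: erow R K j
    + Emx R J K *m (\col_k g (lift ord0 k)) + Zmx z *m t.
Proof.
move=> g0; apply/matrixP=> c i; rewrite ord1; have [j [k ->]] := cellP c.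
rewrite vectabE mxE [RHS]mxE [X in _ = X + _]mxE sum_erowE EmxE ext0P //.
by congr (_ + _); rewrite !mxE; apply: eq_bigr => l _; rewrite ZmxE mxE.
Qed.

Lemma Rspace_Hspace : (Rspace R J K <= Hspace z)%VS.
Proof.
apply/subvP=> _ /RspaceP[r ->]; apply/HspaceP.
(* The effect of row 0 serves as the intercept, which enforces the constraint that rho is 0
   there. *)
exists (r ord0), (fun j => r j - r ord0), (fun=> 0), 0; split=> //.
  by rewrite subrr.
rewrite linpredE // mulmx0 addr0 [X in Emx _ _ _ *m X](_ : _ = 0).
  by rewrite mulmx0 addr0; apply: eq_bigr => j _; rewrite addrC subrK.
by apply/matrixP=> ? ?; rewrite !mxE.
Qed.

Lemma effects_Hspace (v : 'cV[R]_K) (t : 'cV[R]_L) :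
  Emx R J K *m v + Zmx z *m t \in Hspace z.
Proof.
apply/HspaceP; exists 0, (fun=> 0), (ext0 v), t; split; rewrite ?ext0_0 //.
rewrite linpredE ?ext0_0 // big1 ?add0r => [|j _]; last by rewrite ?addr0 scale0r.
congr (_ *m _ + _); apply/matrixP=> k i.
by rewrite ord1 mxE /ext0 liftK.
Qed.

Section ThetaMap.
Variable A : 'M[R]_(L, K.+1 * J.+1).
Hypothesis hA : theta_map z A.

Lemma theta_map_effects (v : 'cV[R]_K) (t : 'cV[R]_L) :
  A *m (Emx R J K *m v + Zmx z *m t) = t.
Proof.
rewrite -[RHS](@hA 0 (fun=> 0) (ext0 v) t) ?ext0_0 // linpredE ?ext0_0 //.
rewrite big1 ?add0r => [|j _]; last by rewrite ?addr0 scale0r.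
congr (_ *m (_ *m _ + _)); apply/matrixP=> k i.
by rewrite ord1 mxE /ext0 liftK.
Qed.

Lemma theta_map_Emx : A *m Emx R J K = 0.
Proof.
apply: eq_mulmxcV => v; rewrite mul0mx -mulmxA.
by have := theta_map_effects v 0; rewrite mulmx0 addr0.
Qed.

Lemma theta_map_Zmx : A *m Zmx z = 1%:M.
Proof.
apply: eq_mulmxcV => t; rewrite mul1mx -mulmxA.
by have := theta_map_effects 0 t; rewrite mulmx0 add0r.
Qed.

Lemma theta_map_Rspace x : x \in Rspace R J K -> A *m x = 0.
Proof.
move=> /RspaceP[r ->].
rewrite -(@hA (r ord0) (fun j => r j - r ord0) (fun=> 0) 0) ?subrr //.
rewrite linpredE // mulmx0 addr0 [X in Emx _ _ _ *m X](_ : _ = 0).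
  by rewrite mulmx0 addr0; congr (_ *m _); apply: eq_bigr => j _; rewrite addrC subrK.
by apply/matrixP=> ? ?; rewrite !mxE.
Qed.

Lemma theta_map_eall : A *m eall R J K = 0.
Proof. by rewrite theta_map_Rspace // rpred_sum // => j _; rewrite memv_erow. Qed.

(** For k > 0 this is a column of E; column 0 is the all-ones table minus the other columns, and the
    all-ones table is a sum of row effects. *)
Lemma theta_map_ecol k : A *m ecol R J k = 0.
Proof.
have ecol_lift i : A *m ecol R J (lift ord0 i) = 0.
  have -> : ecol R J (lift ord0 i) = col i (Emx R J K).
    by apply/matrixP=> c j; rewrite ord1 !mxE.
  by rewrite colE mulmxA theta_map_Emx mul0mx.
case: (unliftP ord0 k) => [i ->|->]; first exact: ecol_lift.
have := theta_map_eall; rewrite /eall exchange_big big_ord_recl mulmxDr.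
rewrite [X in _ + X](_ : _ = 0) ?addr0 //.
by rewrite mulmx_sumr big1 // => i _; exact: ecol_lift.
Qed.

(** Every N is spanned by sums of row or column effects. This is why the covariance of the theta
    estimator is the same under all schemes. *)
Lemma theta_map_Nspace s x : x \in Nspace R J K s -> A *m x = 0.
Proof.
case: s => /=.
- by rewrite memv0 => /eqP ->; rewrite mulmx0.
- by move=> /vlineP[k ->]; rewrite -scalemxAr theta_map_eall scaler0.
- exact: theta_map_Rspace.
rewrite /Cspace => /coord_span ->; rewrite mulmx_sumr big1 // => i _.
rewrite -scalemxAr; set e := nth _ _ _.
have /imageP[k _ ->] : e \in [seq ecol R J k | k : 'I_K.+1].
  by apply: mem_nth; rewrite size_tuple.
by rewrite theta_map_ecol scaler0.
Qed.

End ThetaMap.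
End Model.

(** * Symmetry of the row-multinomial covariance and invertibility on column effects *)

Section CovarianceMR.
Variables (R : realType) (J K : nat) (mu : 'M[R]_(J.+1, K.+1)).
Hypothesis mu_gt0 : forall j k, 0 < mu j k.

Lemma cov_MR_sym : (cov_MR mu)^T = cov_MR mu.
Proof.
have pD := Dmx_posdef mu_gt0.
by rewrite cov_MRE // trmx_mul pD.1 oproj_residual_sym.
Qed.

(** This is the [D]-Gram matrix of the residuals of the columns of E after projection onto the row
    space. If it kills v, the residual of E v has norm 0, so E v lies in the row space and v = 0. *)
Lemma ECE_unitmx : (Emx R J K)^T *m cov_MR mu *m Emx R J K \in unitmx.
Proof.
have pD := Dmx_posdef mu_gt0.
apply: inj_unitmx => v ECEv; apply: (@Emx_Rspace R J K).
set x := Emx R J K *m v; set P := oproj (Dmx mu) (Rspace R J K).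
suff x0 : x - P *m x = 0 by rewrite (subr0_eq x0) oproj_mem.
apply: (posdef_eq0 pD).
have -> : x - P *m x = (1%:M - P) *m x by rewrite mulmxBl mul1mx.
rewrite /dotD trmx_mul -(mulmxA x^T) oproj_residual_sym // -!mulmxA.
rewrite (mulmxA (1%:M - P)) oproj_residual_idem // (mulmxA (Dmx mu)).
rewrite -cov_MRE // /x trmx_mul -(mulmxA v^T) (mulmxA (Emx R J K)^T).
by rewrite (mulmxA (_ *m cov_MR mu)) ECEv mulmx0 mxE.
Qed.

End CovarianceMR.

Theorem theorem3 (R : realType) (J K L : nat) (hJ : (1 <= J)%N) (hK : (1 <= K)%N)
    (z : 'I_J.+1 -> 'I_K.+1 -> 'cV[R]_L)
    (hzj0 : forall j, z j ord0 = 0) (hz0k : forall k, z ord0 k = 0)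
    (hrank : \rank (Zcore z) = L)
    (mu : 'M[R]_(J.+1, K.+1)) (hmu : forall j k, 0 < mu j k)
    (alpha : R) (rho : 'I_J.+1 -> R) (gamma : 'I_K.+1 -> R) (theta : 'cV[R]_L)
    (hrho : rho ord0 = 0) (hgamma : gamma ord0 = 0)
    (hmodel : forall j k,
       ln (mu j k) = alpha + rho j + gamma k + ((z j k)^T *m theta) 0 0)
    (A : 'M[R]_(L, K.+1 * J.+1)) (hA : theta_map z A)
    (s : scheme) :
  let C := cov_MR mu in
  let Z := Zmx z in
  let E := Emx R J K in
  let S := Z^T *m C *m Z
           - Z^T *m C *m E *m invmx (E^T *m C *m E) *m (E^T *m C *m Z) in
  [/\ E^T *m C *m E \in unitmx,
      S \in unitmx
    & acov_lin A (Sigma_eta z mu s) = invmx S].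
Proof.
move=> C Z E S; have pD := Dmx_posdef hmu.
have ECEu := ECE_unitmx hmu; rewrite -/E -/C in ECEu.
set D := Dmx mu in pD *; pose P := oproj D (Rspace R J K).
pose H := oproj D (Hspace z).
(* [F] solves the normal equations [E^T *m C *m (Z - E *m F) = 0]. *)
pose F := invmx (E^T *m C *m E) *m (E^T *m C *m Z).
pose T := (1%:M - P) *m (Z - E *m F).
have CE : C = D *m (1%:M - P) by exact: cov_MRE.
have Csym : C^T = C by exact: cov_MR_sym.
clearbody C.
have TD : T^T *m D = (Z - E *m F)^T *m C.
  by rewrite trmx_mul -mulmxA oproj_residual_sym // CE.
have AP : A *m P = 0 by apply: mul_oproj0 => // x; exact: theta_map_Rspace hA x.
have AT : A *m T = 1%:M.
  have AQ : A *m (1%:M - P) = A by rewrite mulmxBr mulmx1 AP subr0.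
  rewrite mulmxA AQ mulmxBr mulmxA.
  by rewrite (theta_map_Emx hA) mul0mx subr0 (theta_map_Zmx hA).
have TDR x : x \in Rspace R J K -> T^T *m D *m x = 0.
  move=> xR; rewrite TD CE -!mulmxA [(1%:M - P) *m x]mulmxBl mul1mx.
  by rewrite oproj_id // subrr !mulmx0.
have TDE : T^T *m D *m E = 0.
  apply: trmx_inj; rewrite TD !trmx_mul trmxK Csym trmx0 mulmxA mulmxBr.
  by rewrite (mulmxA _ E) /F mulKVmx // subrr.
have TDZ : T^T *m D *m Z = S.
  rewrite TD linearB /= !mulmxBl /S; congr (_ - _).
  rewrite /F !trmx_mul trmx_inv !trmx_mul !trmxK Csym.
  by rewrite !mulmxA.
(* Of the three components in [linpredE] only the Z part survives, by [TDR] and [TDE]. *)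
have TDH h : h \in Hspace z -> T^T *m D *m h = S *m (A *m h).
  move=> /HspaceP[a [r [g [t [r0 g0 ->]]]]]; rewrite hA // linpredE //.
  rewrite !mulmxDr TDR ?add0r; last by apply/RspaceP; exists (fun j => a + r j).
  by rewrite !mulmxA TDE mul0mx add0r TDZ.
(* [Z - E *m F] has columns in the model space, and subtracting their row-space projections stays
   inside it. *)
have HT : H *m T = T.
  apply: eq_mulmxcV => x; rewrite -mulmxA oproj_id // /T -mulmxA.
  rewrite mulmxBl mul1mx rpredB //; last first.
    by apply: (subvP (Rspace_Hspace z)); exact: oproj_mem.
  by rewrite mulmxBl addrC -!mulmxA -mulmxN; exact: effects_Hspace.
(* [TDH] on the columns of [H] gives [T^T *m D *m H]; self-adjointness moves [H] onto [T], which it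
   fixes. *)
have SAH : S *m (A *m H) = T^T *m D.
  transitivity (T^T *m D *m H).
    by apply: eq_mulmxcV => x; rewrite -!mulmxA -TDH ?mulmxA // oproj_mem.
  by rewrite -mulmxA -oproj_selfadj // mulmxA -trmx_mul HT.
have SV : S *m acov_lin A (Sigma_eta z mu s) = 1%:M.
  have AN : A *m oproj D (Nspace R J K s) = 0.
    by apply: mul_oproj0 => // x; exact: theta_map_Nspace hA s x.
  rewrite /acov_lin /Sigma_eta !mulmxA -(mulmxA S) mulmxBr AN subr0 SAH.
  by rewrite mulmxK ?posdef_unitmx // -trmx_mul AT trmx1.
(* A right inverse of a square matrix is two-sided, so [SV] yields both the invertibility of [S] and
   its inverse. *)
have [Su _] := mulmx1_unit SV; split=> //.
by rewrite -[LHS](mulKmx Su) SV mulmx1.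
Qed.
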